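(* Let $J\colon\mathcal S_n\to\mathbb R$ be strictly isotone and let Assumption (A1) hold. Then problem (SDP) and problem (CI) are equivalent in the following sense: $(\boldsymbol\alpha^\ast,\boldsymbol K_1^\ast,\boldsymbol K_2^\ast,\hat{\boldsymbol P}^\ast)$ (a map $\mathcal D_F\to\mathbb R\times\mathbb R^{n\times p_1}\times\mathbb R^{n\times p_2}\times\mathcal P_n$) is a solution of problem (SDP) if and only if $\boldsymbol\alpha^\ast$ is a solution of problem (CI) and $(\boldsymbol K_1^\ast,\boldsymbol K_2^\ast,\hat{\boldsymbol P}^\ast)=(\boldsymbol K_1^{\boldsymbol\alpha^\ast},\boldsymbol K_2^{\boldsymbol\alpha^\ast},\hat{\boldsymbol P}^{\boldsymbol\alpha^\ast})$.
   Context: $n,p_1,p_2$ are positive integers, $p_1,p_2\le n$, $H_1\in\mathbb R^{p_1\times n}$, $H_2\in\mathbb R^{p_2\times n}$, $H=\begin{pmatrix}H_1\\H_2\end{pmatrix}$. Assumption (A1): $\mathrm{rk}(H_1)=p_1$, $\mathrm{rk}(H_2)=p_2$, $\mathrm{rk}(H)=n$ (and the two input estimators $\hat x_1,\hat x_2$ are unbiased estimators of $H_1x_{\rm true}$, $H_2x_{\rm true}$; in the deterministic maps below only their values enter). $\mathcal S_m,\mathcal P_m,\mathcal P_m^\succ$: real symmetric, positive semi-definite, positive definite $m\times m$ matrices; $\preceq$ is the Löwner order; $M^{1/2}$ is the positive semi-definite square root. $\mathcal D_F:=\mathbb R^{p_1}\times\mathbb R^{p_2}\times\mathcal P_{p_1}^\succ\times\mathcal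 P_{p_2}^\succ$, with points denoted $(\hat x_1,\hat x_2,\hat P_1,\hat P_2)$. All statements about maps on $\mathcal D_F$ are read pointwise on $\mathcal D_F$. $J$ is strictly isotone if $A\preceq B$ implies $J(A)\le J(B)$ and ($A\preceq B$, $A\ne B$) implies $J(A)<J(B)$, for all $A,B\in\mathcal S_n$. Problem (SDP): pointwise at each $(\hat x_1,\hat x_2,\hat P_1,\hat P_2)\in\mathcal D_F$, minimize $J(\hat{\boldsymbol P})$ over $(\boldsymbol\alpha,\boldsymbol K_1,\boldsymbol K_2,\hat{\boldsymbol P})\in\mathbb R\times\mathbb R^{n\times p_1}\times\mathbb R^{n\times p_2}\times\mathcal P_n$ subject to $$\begin{pmatrix}\hat{\boldsymbol P}&\boldsymbol K_1\hat P_1^{1/2}&\boldsymbol K_2\hat P_2^{1/2}\\ \hat P_1^{1/2}\boldsymbol K_1^\top&\boldsymbol\alpha I&0\\ \hat P_2^{1/2}\boldsymbol K_2^\top&0&(1-\boldsymbol\alpha)I\end{pmatrix}\succeq0,\qquad \boldsymbol K_1H_1+\boldsymbol K_2H_2=I.$$ A solution is a map on $\mathcal D_F$ whose value at each point is feasible and minimizes $J(\hat{\boldsymbol P})$ among all feasible values at that point. Extend $J$ to $\bar J\colon\mathcal S_n\cup\{+\infty\}\to\mathbb R\cup\{+\infty\}$ by $\bar J(+\infty)=+\infty$ and $\bar J=J$ on $\mathcal S_n$, and set $P^{-1}:=+\infty$ for singular $P\in\mathcal P_n$. Problem (CI): a solution is a function $\boldsymbol\alpha^\ast\colon\mathcal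 D_F\to[0,1]$ such that at every point of $\mathcal D_F$ and for every function $\boldsymbol\alpha\colon\mathcal D_F\to[0,1]$, $\bar J((\boldsymbol\alpha^\ast H_1^\top\hat P_1^{-1}H_1+(1-\boldsymbol\alpha^\ast)H_2^\top\hat P_2^{-1}H_2)^{-1})\le\bar J((\boldsymbol\alpha H_1^\top\hat P_1^{-1}H_1+(1-\boldsymbol\alpha)H_2^\top\hat P_2^{-1}H_2)^{-1})$. For $\boldsymbol\alpha\colon\mathcal D_F\to[0,1]$ (wherever the matrix being inverted is non-singular): $\hat{\boldsymbol P}^{\boldsymbol\alpha}:=(\boldsymbol\alpha H_1^\top\hat P_1^{-1}H_1+(1-\boldsymbol\alpha)H_2^\top\hat P_2^{-1}H_2)^{-1}$, $\boldsymbol K_1^{\boldsymbol\alpha}:=\boldsymbol\alpha\hat{\boldsymbol P}^{\boldsymbol\alpha}H_1^\top\hat P_1^{-1}$, $\boldsymbol K_2^{\boldsymbol\alpha}:=(1-\boldsymbol\alpha)\hat{\boldsymbol P}^{\boldsymbol\alpha}H_2^\top\hat P_2^{-1}$. *)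

(* Defs.v *)
(* The reals are an arbitrary R : realType. *)
From mathcomp Require Import all_boot all_order all_algebra.
From mathcomp Require Import boolp classical_sets reals constructive_ereal.

Set Implicit Arguments.
Unset Strict Implicit.
Unset Printing Implicit Defensive.

Import Order.TTheory GRing.Theory Num.Theory.
Local Open Scope classical_set_scope.
Local Open Scope ring_scope.

Definition psdmx (R : realType) m (A : 'M[R]_m) : Prop :=
  A \is symmetricmx /\ forall x : 'cV[R]_m, 0 <= (x^T *m A *m x) 0 0.

Definition pdmx (R : realType) m (A : 'M[R]_m) : Prop :=
  A \is symmetricmx /\
  forall x : 'cV[R]_m, x != 0 -> 0 < (x^T *m A *m x) 0 0.

(* The Loewner order. *)
Definition lemx (R : realType) m (A B : 'M[R]_m) : Prop := psdmx (B - A).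

(* The positive semi-definite square root: the set below is a singleton when
   M is positive semi-definite, and the value is the junk 0 when it is empty. *)
Definition sqrtmx (R : realType) m (M : 'M[R]_m) : 'M[R]_m :=
  xget 0 [set S : 'M[R]_m | psdmx S /\ S *m S = M].

(* A cost on symmetric matrices is represented by a function on all square
   matrices, whose values off the symmetric ones are never constrained. *)
Definition strictly_isotone (R : realType) n (J : 'M[R]_n -> R) : Prop :=
  forall A B : 'M[R]_n, A \is symmetricmx -> B \is symmetricmx ->
    (lemx A B -> J A <= J B) /\ (lemx A B -> A != B -> J A < J B).

(* Points (x1, x2, P1, P2) of the domain D_F. *)
Record fusion_input (R : realType) (p1 p2 : nat) := FusionInput {
  xhat1 : 'cV[R]_p1;
  xhat2 : 'cV[R]_p2;
  Phat1 : 'M[R]_p1;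
  Phat2 : 'M[R]_p2;
  Phat1_pd : pdmx Phat1;
  Phat2_pd : pdmx Phat2
}.

Section Fusion.

Variables (R : realType) (n p1 p2 : nat).
Variables (H1 : 'M[R]_(p1, n)) (H2 : 'M[R]_(p2, n)).
Variable J : 'M[R]_n -> R.

Local Notation DF := (fusion_input R p1 p2).

Definition rank_assumption : Prop :=
  [/\ \rank H1 = p1, \rank H2 = p2 & \rank (col_mx H1 H2) = n].

Definition sdp_matrix (d : DF) (alpha : R) (K1 : 'M[R]_(n, p1))
    (K2 : 'M[R]_(n, p2)) (P : 'M[R]_n) : 'M[R]_(n + (p1 + p2)) :=
  let S1 := sqrtmx (Phat1 d) in
  let S2 := sqrtmx (Phat2 d) in
  block_mx P (row_mx (K1 *m S1) (K2 *m S2))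
           (col_mx (S1 *m K1^T) (S2 *m K2^T))
           (block_mx alpha%:M 0 0 (1 - alpha)%:M).

Definition sdp_feasible (d : DF) (alpha : R) (K1 : 'M[R]_(n, p1))
    (K2 : 'M[R]_(n, p2)) (P : 'M[R]_n) : Prop :=
  [/\ psdmx P, psdmx (sdp_matrix d alpha K1 K2 P)
    & K1 *m H1 + K2 *m H2 = 1%:M].

Definition sdp_solution (alpha : DF -> R) (K1 : DF -> 'M[R]_(n, p1))
    (K2 : DF -> 'M[R]_(n, p2)) (P : DF -> 'M[R]_n) : Prop :=
  forall d : DF,
    sdp_feasible d (alpha d) (K1 d) (K2 d) (P d) /\
    forall a L1 L2 Q, sdp_feasible d a L1 L2 Q -> J (P d) <= J Q.

Definition ci_information (d : DF) (a : R) : 'M[R]_n :=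
  a *: (H1^T *m invmx (Phat1 d) *m H1) +
  (1 - a) *: (H2^T *m invmx (Phat2 d) *m H2).

(* In option 'M[R]_n, None stands for the adjoined element +oo. *)
Definition extended_inverse (P : 'M[R]_n) : option 'M[R]_n :=
  if P \in unitmx then Some (invmx P) else None.

Definition extended_cost (X : option 'M[R]_n) : \bar R :=
  if X is Some P then (J P)%:E else +oo%E.

Definition ci_cost (d : DF) (a : R) : \bar R :=
  extended_cost (extended_inverse (ci_information d a)).

Definition unit_valued (alpha : DF -> R) : Prop :=
  forall d : DF, 0 <= alpha d <= 1.

Definition ci_solution (alpha : DF -> R) : Prop :=
  unit_valued alpha /\
  forall (d : DF) (beta : DF -> R), unit_valued beta ->
    (ci_cost d (alpha d) <= ci_cost d (beta d))%E.

(* Meaningful when ci_information d a is invertible, which is the case at every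
   point for a solution of (CI): the cost there is finite at a = 1/2. *)
Definition ci_cov (d : DF) (a : R) : 'M[R]_n := invmx (ci_information d a).

Definition ci_gain1 (d : DF) (a : R) : 'M[R]_(n, p1) :=
  a *: (ci_cov d a *m H1^T *m invmx (Phat1 d)).

Definition ci_gain2 (d : DF) (a : R) : 'M[R]_(n, p2) :=
  (1 - a) *: (ci_cov d a *m H2^T *m invmx (Phat2 d)).

End Fusion.

(* Main.v *)
Require Import Defs.
From mathcomp Require Import all_boot all_order all_algebra.
From mathcomp Require Import boolp classical_sets reals constructive_ereal.
From mathcomp Require Import complex ring lra.

Set Implicit Arguments.
Unset Strict Implicit.
Unset Printing Implicit Defensive.

Import Order.TTheory GRing.Theory Num.Theory.
(** The argument is local: at a fixed point of the domain, minimizing over the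
    gains and the covariance for a given weight [a] is solved exactly by the
    covariance-intersection formula, so that only the minimization over [a]
    remains on both sides.

    Write [S_i] for the square root of the i-th covariance and substitute
    [N_i = K_i S_i], [Y_i = S_i^-1 H_i].  The covariances disappear: the
    constraint becomes [N1 Y1 + N2 Y2 = 1], the information matrix becomes
    [W = a Y1^T Y1 + (1 - a) Y2^T Y2], and the linear matrix inequality says that
    the arrow-shaped matrix [arrow_mx a N1 N2 Q] is positive semi-definite.
    Evaluating that form on the block column [(A, - Y1 B, - Y2 B)] gives, thanks
    to the constraint,
      [A^T Q A - A^T B - B^T A + B^T W B]    (lemma [arrow_mx_form]),
    in which the gains no longer occur.  Everything follows from this identity.
    - Taking [B] in the kernel of [W] and [A = t B] with [t] arbitrary forces
      [B = 0], so feasibility implies that [W] is invertible.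
    - Taking [A = 1] and [B = W^-1] gives [Q - W^-1], so [W^-1 <= Q].
    - If [Q = W^-1], that block column is isotropic for a positive semi-definite
      form, hence lies in its kernel, and reading the lower blocks of this
      relation yields the gains: the optimal gains are unique.
    Conversely, at these gains and at [Q = W^-1] the arrow matrix is
    [a Z1^T Z1 + (1 - a) Z2^T Z2] for explicit [Z_i], hence positive
    semi-definite when [a] lies in [[0, 1]].  Division by [a] or by [1 - a], as in
    a Schur complement, never occurs, so the endpoints of [[0, 1]] are not special.

    Strict isotony then makes [W^-1] the only minimizer for each weight.  A solution
    of the intersection problem has an invertible information matrix because
    the weight 1/2 has finite cost ([ci_information_half_unit]), which is where
    the rank condition on the stacked observation matrix enters.

    The square root is defined by choice, so its existence has to be proved
    ([psdmx_sqrt_exists]): a real symmetric matrix becomes diagonal over the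
    complex numbers, and a real polynomial in the matrix that interpolates the
    fourth root on the spectrum squares to a square root. *)

Local Open Scope ring_scope.

(** * Positive semi-definite matrices *)

Section PositiveSemidefinite.
Variable R : realType.

Lemma symmetricmxP n (A : 'M[R]_n) : A \is symmetricmx <-> A^T = A.
Proof.
split=> [/is_hermitianmxP|symA].
  by rewrite expr0 scale1r map_mx_id // => /esym.
by apply/is_hermitianmxP; rewrite expr0 scale1r map_mx_id.
Qed.

Lemma mulmx_tr_self_ge0 n (x : 'cV[R]_n) : 0 <= (x^T *m x) 0 0.
Proof. by rewrite mxE sumr_ge0 // => i _; rewrite mxE -expr2 sqr_ge0. Qed.

Lemma mulmx_tr_self_eq0 n (x : 'cV[R]_n) : (x^T *m x) 0 0 = 0 -> x = 0.
Proof.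
rewrite mxE => sum0; apply/colP => i; rewrite mxE.
have terms_ge0 j : true -> 0 <= x^T 0 j * x j 0.
  by rewrite mxE -expr2 sqr_ge0.
have /eqP := psumr_eq0P terms_ge0 sum0 (i := i) isT.
by rewrite mxE -expr2 sqrf_eq0 => /eqP.
Qed.

(** The cases [t = 1] and [t = -1] together give [c >= 0].  If [b] were nonzero,
    [t = - b / (c + 1)] would make the expression negative; the denominator is
    [c + 1] because [c] may vanish. *)
Lemma nonneg_quadratic_linear_coef_eq0 (b c : R) :
  (forall t, 0 <= t * b *+ 2 + t ^+ 2 * c) -> b = 0.
Proof.
move=> nonneg; have c_ge0 : 0 <= c by have := nonneg 1; have := nonneg (-1); lra.
apply/eqP; rewrite -sqrf_eq0 eq_le sqr_ge0 andbT.
have c1 : c + 1 != 0 by rewrite gt_eqF // ltr_wpDl.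
have := nonneg (- b / (c + 1)).
have -> : - b / (c + 1) * b *+ 2 + (- b / (c + 1)) ^+ 2 * c =
          - (b ^+ 2 * ((c + 2) / (c + 1) ^+ 2)) by field.
by rewrite oppr_ge0 pmulr_lle0 // divr_gt0 ?exprn_gt0 //; lra.
Qed.

Lemma psdmx_gram m n (X : 'M[R]_(m, n)) : psdmx (X^T *m X).
Proof.
split=> [|x]; first by apply/symmetricmxP; rewrite trmx_mul trmxK.
by rewrite mulmxA -trmx_mul -mulmxA mulmx_tr_self_ge0.
Qed.

Lemma psdmxD n (A B : 'M[R]_n) : psdmx A -> psdmx B -> psdmx (A + B).
Proof.
move=> [/symmetricmxP sA pA] [/symmetricmxP sB pB]; split=> [|x].
  by apply/symmetricmxP; rewrite linearD /= sA sB.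
by rewrite mulmxDr mulmxDl mxE addr_ge0.
Qed.

Lemma psdmxZ n (a : R) (A : 'M[R]_n) : 0 <= a -> psdmx A -> psdmx (a *: A).
Proof.
move=> a0 [/symmetricmxP sA pA]; split=> [|x].
  by apply/symmetricmxP; rewrite linearZ /= sA.
by rewrite -scalemxAr -scalemxAl mxE mulr_ge0.
Qed.

Lemma psdmx_congr m n (A : 'M[R]_m) (X : 'M[R]_(m, n)) :
  psdmx A -> psdmx (X^T *m A *m X).
Proof.
move=> [/symmetricmxP sA pA]; split=> [|x].
  by apply/symmetricmxP; rewrite !trmx_mul trmxK sA mulmxA.
by rewrite !mulmxA -trmx_mul -!mulmxA mulmxA.
Qed.

(** A positive semi-definite form is nonnegative at [x + t y] for every [t], so an
    isotropic [x] is orthogonal to every [y], in particular to [y = A x]. *)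
Lemma psdmx_isotropic m n (A : 'M[R]_m) (X : 'M[R]_(m, n)) :
  psdmx A -> X^T *m A *m X = 0 -> A *m X = 0.
Proof.
move=> [/symmetricmxP sA pA] X0.
suff colAX j : A *m col j X = 0.
  apply/matrixP => i j.
  by have /colP/(_ i) := colAX j; rewrite colE mulmxA -colE !mxE.
set x := col j X; apply: mulmx_tr_self_eq0; set y := A *m x.
apply: (@nonneg_quadratic_linear_coef_eq0 _ ((y^T *m A *m y) 0 0)) => t.
have xAx : x^T *m A *m x = 0.
  by rewrite /x [X in _ *m X]colE tr_col -row_mul mulmxA -row_mul X0 linear0 mul0mx.
have := pA (t *: y + x).
rewrite [(_ + _)^T]linearD /= [(t *: y)^T]linearZ /= mulmxDr !mulmxDl xAx addr0.
have -> : x^T *m A *m (t *: y) = t *: (y^T *m y).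
  by rewrite -scalemxAr -{1}sA -trmx_mul.
rewrite -!scalemxAl -scalemxAr -mulmxA -/y scalerA -expr2 !mxE.
by congr (0 <= _); ring.
Qed.

Lemma unitmx_inj_mul n (A : 'M[R]_n) :
  (forall x : 'cV[R]_n, A *m x = 0 -> x = 0) -> A \in unitmx.
Proof.
move=> injA; rewrite -unitmx_tr -row_free_unit; apply: inj_row_free => v vA.
apply: trmx_inj; rewrite trmx0; apply: injA.
by rewrite -[A]trmxK -trmx_mul vA trmx0.
Qed.

End PositiveSemidefinite.

(** * Existence of the positive semi-definite square root *)

Lemma trmx_horner_mx (R : comNzRingType) n (A : 'M[R]_n.+1) (p : {poly R}) :
  (horner_mx A p)^T = horner_mx A^T p.
Proof.
elim/poly_ind: p => [|p c IHp]; first by rewrite !raddf0.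
rewrite !rmorphD !rmorphM /= !horner_mx_X !horner_mx_C linearD /= tr_scalar_mx.
rewrite [(_ * _)^T]trmx_mul IHp; congr (_ + _).
exact: (comm_mx_horner _ (comm_mx_refl _)).
Qed.

(** Newton interpolation: each new node is corrected by a multiple of the
    polynomial vanishing at the previous nodes. *)
Lemma poly_interpolation (F : fieldType) (f : F -> F) (s : seq F) :
  exists p : {poly F}, {in s, forall x, p.[x] = f x}.
Proof.
elim: s => [|a s [p pf]]; first by exists 0.
case: (boolP (a \in s)) => [a_s|aNs].
  by exists p => x; rewrite inE => /predU1P[->|]; exact: pf.
pose q := \prod_(b <- s) ('X - b%:P).
have qa : q.[a] != 0 by rewrite -/(root q a) root_prod_XsubC.
exists (p + ((f a - p.[a]) / q.[a]) *: q) => x; rewrite inE !hornerE.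
case/predU1P => [->|xs]; first by rewrite divfK // addrC subrK.
have /rootP -> : root q x by rewrite root_prod_XsubC.
by rewrite mulr0 addr0 pf.
Qed.

Section SquareRoot.
Variable R : realType.

(** A complexified real symmetric matrix is Hermitian, so the complex spectral
    theorem applies and its eigenvalues are real.  The change of basis may stay
    complex: only polynomials in [M] are formed from this decomposition. *)
Lemma symmetricmx_diagonalizable n (M : 'M[R]_n) : M \is symmetricmx ->
  exists (d : 'rV[R]_n) (U : 'M[R[i]]_n), U \in unitmx /\
    map_mx (real_complex R) M =
    invmx U *m diag_mx (map_mx (real_complex R) d) *m U.
Proof.
move=> /symmetricmxP symM.
have symMC : map_mx (real_complex R) M \is symmetricmx.
  by apply/is_hermitianmxP; rewrite expr0 scale1r map_mx_id // map_trmx symM.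
have realMC : map_mx (real_complex R) M \is a mxOver Num.real.
  by apply/mxOverP => i j; rewrite mxE complex_real.
have hermMC := realsym_hermsym symMC realMC.
have /orthomx_spectralP eqM := hermitian_normalmx hermMC.
have /mxOverP realD := hermitian_spectral_diag_real hermMC.
set D := spectral_diag _ in eqM realD; set U := spectralmx _ in eqM.
exists (map_mx (@complex.Re R) D), U; split; first exact: spectral_unit.
rewrite {1}eqM; congr (_ *m diag_mx _ *m _).
by apply/rowP => j; rewrite !mxE RRe_real.
Qed.

Lemma psdmx_eigenvalue_ge0 n (M : 'M[R]_n) a :
  psdmx M -> eigenvalue M a -> 0 <= a.
Proof.
move=> [_ psdM] /eigenvalueP[v vM v0].
have := psdM v^T; rewrite trmxK vM -scalemxAl mxE.
rewrite -[v in v *m _]trmxK pmulr_lge0 //.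
rewrite lt_def mulmx_tr_self_ge0 andbT; apply: contra v0 => /eqP.
by move/mulmx_tr_self_eq0 => v0; rewrite -[v]trmxK v0 trmx0.
Qed.

(** The root is sought among the polynomials in [M], which are real and symmetric
    from the start.  Interpolating the fourth root [r] rather than the square
    root makes positivity immediate: [r(M)^2 = r(M)^T r(M)] is a Gram matrix. *)
Lemma psdmx_sqrt_exists n (M : 'M[R]_n) :
  psdmx M -> exists S : 'M[R]_n, psdmx S /\ S *m S = M.
Proof.
case: n M => [M _|n M psdM].
  exists (1%:M^T *m 1%:M); split; first exact: psdmx_gram.
  by rewrite [LHS]flatmx0 [RHS]flatmx0.
have [d [U [unitU eqM]]] := symmetricmx_diagonalizable psdM.1.
have d_ge0 i : 0 <= d 0 i.
  apply: (psdmx_eigenvalue_ge0 psdM).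
  rewrite -(eigenvalue_map (real_complex R)).
  (* The rows of U are left eigenvectors, since U M = diag(d) U. *)
  apply/eigenvalueP; exists (row i U).
    rewrite -row_mul eqM !mulmxA mulmxV // mul1mx row_mul row_diag_mx.
    by rewrite -scalemxAl -rowE mxE.
  apply: contraTneq unitU => Ui0.
  rewrite -row_free_unit; apply/negP => /row_freeP[V UV].
  have := congr1 (row i) UV; rewrite row_mul Ui0 mul0mx => /rowP/(_ i).
  by rewrite !mxE eqxx => /esym/eqP; rewrite oner_eq0.
(* r is the fourth root on the spectrum of M. *)
have [r rE] := poly_interpolation (fun x => Num.sqrt (Num.sqrt x))
  [seq d 0 i | i <- enum 'I_n.+1].
pose T := horner_mx M r.
have symT : T^T = T by rewrite trmx_horner_mx (symmetricmxP _).1 //; exact: psdM.1.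
exists (T^T *m T); split; first exact: psdmx_gram.
have -> : T^T *m T *m (T^T *m T) = horner_mx M (r ^+ 4).
  by rewrite symT /T !mulmxE -!rmorphM /= -!expr2 -exprM.
apply: (map_mx_inj (f := real_complex R)).
rewrite map_horner_mx eqM horner_mx_uconjC // horner_mx_diag.
congr (_ *m diag_mx _ *m _); apply/rowP => i; rewrite !mxE.
rewrite horner_map horner_exp rE; last by apply: map_f; rewrite mem_enum.
rewrite (exprM _ 2 2) !sqr_sqrtr ?sqrtr_ge0 //.
Qed.

End SquareRoot.

(** * The whitened problem *)

Section WhitenedFusion.
Variables (R : realType) (n p1 p2 : nat).
Variables (Y1 : 'M[R]_(p1, n)) (Y2 : 'M[R]_(p2, n)).
Implicit Type a : R.

Definition weighted_gram a : 'M[R]_n :=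
  a *: (Y1^T *m Y1) + (1 - a) *: (Y2^T *m Y2).

Definition weighted_cov a : 'M[R]_n := invmx (weighted_gram a).

Definition arrow_mx a (N1 : 'M[R]_(n, p1)) (N2 : 'M[R]_(n, p2))
    (Q : 'M[R]_n) : 'M[R]_(n + (p1 + p2)) :=
  block_mx Q (row_mx N1 N2) (col_mx N1^T N2^T) (block_mx a%:M 0 0 (1 - a)%:M).

(** The lower blocks are chosen so that, under the unbiasedness constraint, the
    gains cancel when the arrow matrix is evaluated on this block column. *)
Definition probe m (A B : 'M[R]_(n, m)) : 'M[R]_(n + (p1 + p2), m) :=
  col_mx A (col_mx (- (Y1 *m B)) (- (Y2 *m B))).

Lemma psdmx_weighted_gram a : 0 <= a <= 1 -> psdmx (weighted_gram a).
Proof.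
move=> /andP[a0 a1]; apply: psdmxD; apply: psdmxZ; rewrite ?subr_ge0 //;
  exact: psdmx_gram.
Qed.

Lemma trmx_weighted_cov a :
  (weighted_cov a)^T = weighted_cov a.
Proof.
rewrite /weighted_cov trmx_inv /weighted_gram linearD /= !linearZ /=.
by rewrite !trmx_mul !trmxK.
Qed.

(** The lower diagonal blocks are [a] and [1 - a] times identities of positive
    size, so both scalars appear on the diagonal. *)
Lemma arrow_mx_weight a N1 N2 Q : (0 < p1)%N -> (0 < p2)%N ->
  psdmx (arrow_mx a N1 N2 Q) -> 0 <= a <= 1.
Proof.
move=> p1_gt0 p2_gt0 [_ psd].
have diag i : 0 <= arrow_mx a N1 N2 Q i i.
  by have := psd (delta_mx i 0); rewrite trmx_delta -rowE -colE !mxE.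
have := diag (rshift n (lshift p2 (Ordinal p1_gt0))).
have := diag (rshift n (rshift p1 (Ordinal p2_gt0))).
rewrite !block_mxEdr block_mxEul !mxE !eqxx !mulr1n subr_ge0.
by move=> -> ->.
Qed.

Section Bound.
Variables (a : R) (N1 : 'M[R]_(n, p1)) (N2 : 'M[R]_(n, p2)) (Q : 'M[R]_n).
Hypothesis unbiased : N1 *m Y1 + N2 *m Y2 = 1%:M.

Lemma mul_arrow_mx_probe m (A B : 'M[R]_(n, m)) :
  arrow_mx a N1 N2 Q *m probe A B =
  col_mx (Q *m A - B) (col_mx (N1^T *m A - a *: (Y1 *m B))
                              (N2^T *m A - (1 - a) *: (Y2 *m B))).
Proof.
rewrite /probe mul_block_col mul_row_col mul_block_col !mul0mx addr0 add0r.
rewrite mul_col_mx add_col_mx !mulmxN !mul_scalar_mx !mulmxA -opprD -mulmxDl.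
by rewrite unbiased mul1mx.
Qed.

(** The gains enter only through [N1 Y1 + N2 Y2], so that the form seen by probes
    depends only on the candidate covariance and on the information matrix. *)
Lemma arrow_mx_form m (A B : 'M[R]_(n, m)) :
  (probe A B)^T *m arrow_mx a N1 N2 Q *m probe A B =
  A^T *m Q *m A - A^T *m B - B^T *m A + B^T *m weighted_gram a *m B.
Proof.
rewrite -mulmxA mul_arrow_mx_probe /probe !tr_col_mx !mul_row_col.
rewrite !linearN /= !trmx_mul.
rewrite /weighted_gram !(mulmxBr, mulmxDr, mulmxDl, mulNmx, mulmxA) -!scalemxAr.
rewrite !mulmxN !opprK -!scalemxAl -!scalemxAr !mulmxA.
have -> : B^T *m A = B^T *m Y1^T *m N1^T *m A + B^T *m Y2^T *m N2^T *m A.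
  rewrite -mulmxDl -!mulmxA -mulmxDr -!trmx_mul -linearD /= unbiased.
  by rewrite trmx1 mulmx1.
by rewrite !opprD !addrA; congr (_ + _); rewrite addrAC.
Qed.

Hypothesis psd : psdmx (arrow_mx a N1 N2 Q).

(** For [x] in the kernel, the form at the probe [(t x, x)] is
    [t^2 (x^T Q x) - 2 t (x^T x)]; being nonnegative for all [t], it has no linear
    term. *)
Lemma weighted_gram_unit : weighted_gram a \in unitmx.
Proof.
apply: unitmx_inj_mul => x Wx; apply: mulmx_tr_self_eq0.
apply/eqP; rewrite -oppr_eq0; apply/eqP.
apply: (@nonneg_quadratic_linear_coef_eq0 _ _ ((x^T *m Q *m x) 0 0)) => t.
have [_ /(_ 1%:M)] := psdmx_congr
  (probe (t *: x) x) psd.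
rewrite trmx1 mul1mx mulmx1 arrow_mx_form -[_ *m weighted_gram a *m _]mulmxA Wx.
rewrite mulmx0 addr0 [(t *: x)^T]linearZ /= -!scalemxAl -!scalemxAr scalerA -expr2 !mxE.
by congr (0 <= _); ring.
Qed.

Local Notation C := (weighted_cov a).

(** The probe minimizing the form for [A = 1], whose value is the Schur-type
    complement that controls the covariance. *)
Lemma arrow_mx_form_inv :
  (probe 1%:M C)^T *m arrow_mx a N1 N2 Q *m probe 1%:M C = Q - C.
Proof.
rewrite arrow_mx_form.
rewrite trmx1 !mul1mx !mulmx1.
rewrite trmx_weighted_cov.
by rewrite mulVmx ?weighted_gram_unit // mul1mx subrK.
Qed.

Lemma weighted_cov_le : lemx C Q.
Proof. by rewrite /lemx -arrow_mx_form_inv; exact: psdmx_congr. Qed.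

(** At equality the minimizing probe is isotropic, hence in the kernel of the arrow
    matrix; the lower blocks of the product are [N_i^T] minus the transposed
    gain. *)
Lemma optimal_gain_unique :
  Q = C -> N1 = a *: (C *m Y1^T) /\ N2 = (1 - a) *: (C *m Y2^T).
Proof.
move=> QC; have := arrow_mx_form_inv; rewrite [in X in _ = X]QC subrr.
move=> /(psdmx_isotropic psd); rewrite mul_arrow_mx_probe !mulmx1.
rewrite -(col_mx0 R n (p1 + p2)).
rewrite -(col_mx0 R p1 p2).
move=> /eq_col_mx[_ /eq_col_mx[/subr0_eq g1 /subr0_eq g2]].
split; [rewrite -[N1]trmxK g1 | rewrite -[N2]trmxK g2];
  by rewrite linearZ /= trmx_mul trmx_weighted_cov.
Qed.

End Bound.

Section Attained.
Variable a : R.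
Hypotheses (a01 : 0 <= a <= 1) (unitW : weighted_gram a \in unitmx).
Local Notation C := (weighted_cov a).

Lemma psdmx_weighted_cov : psdmx C.
Proof.
have := psdmx_congr C (psdmx_weighted_gram a01).
by rewrite -mulmxA mulmxV // mulmx1 trmx_weighted_cov.
Qed.

Lemma optimal_gain_unbiased :
  (a *: (C *m Y1^T)) *m Y1 + ((1 - a) *: (C *m Y2^T)) *m Y2 = 1%:M.
Proof.
rewrite -!scalemxAl -!mulmxA [a *: _]scalemxAr [(1 - a) *: _]scalemxAr -mulmxDr.
exact: mulVmx.
Qed.

(** With the optimal gains the arrow matrix is a weighted sum of two Gram matrices,
    one for each observation; its upper left block is [C W C = C]. *)
Lemma psdmx_arrow_optimal :
  psdmx (arrow_mx a (a *: (C *m Y1^T)) ((1 - a) *: (C *m Y2^T)) C).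
Proof.
pose Z1 : 'M_(p1, n + (p1 + p2)) := row_mx (Y1 *m C) (row_mx 1%:M 0).
pose Z2 : 'M_(p2, n + (p1 + p2)) := row_mx (Y2 *m C) (row_mx 0 1%:M).
have -> : arrow_mx a (a *: (C *m Y1^T)) ((1 - a) *: (C *m Y2^T)) C =
          a *: (Z1^T *m Z1) + (1 - a) *: (Z2^T *m Z2).
  rewrite /Z1 /Z2 !tr_row_mx !mul_col_row !mul_col_mx !mul_mx_row !trmx1 !trmx0.
  rewrite !mul1mx !mul0mx !mulmx1 !mulmx0.
  rewrite !scale_block_mx !scale_row_mx !scale_col_mx.
  rewrite !add_block_mx !add_row_mx !add_col_mx !scaler0 !addr0 !add0r.
  rewrite /arrow_mx !linearZ /= !trmx_mul !trmxK trmx_weighted_cov !scalemx1.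
  congr (block_mx _ _ _ _); rewrite -[LHS]mul1mx -optimal_gain_unbiased.
  by rewrite mulmxDl -!scalemxAl !mulmxA.
move/andP: a01 => [a0 a1]; apply: psdmxD; apply: psdmxZ; rewrite ?subr_ge0 //;
  exact: psdmx_gram.
Qed.

End Attained.
End WhitenedFusion.

(** * Whitening by the square root *)

Section SqrtWhitening.
Variables (R : realType) (m : nat) (M : 'M[R]_m).
Hypothesis pdM : pdmx M.

Lemma pdmx_psdmx : psdmx M.
Proof.
split=> [|x]; first exact: pdM.1.
by have [->|/pdM.2/ltW//] := eqVneq x 0; rewrite mulmx0 mxE.
Qed.

Lemma pdmx_unit : M \in unitmx.
Proof.
apply: unitmx_inj_mul => x Mx; apply: contra_eq (erefl (0 : R)) => /pdM.2.
by rewrite -mulmxA Mx mulmx0 mxE ltxx.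
Qed.

Lemma sqrtmxP : psdmx (sqrtmx M) /\ sqrtmx M *m sqrtmx M = M.
Proof. exact: (xgetPex 0 (psdmx_sqrt_exists pdmx_psdmx)). Qed.

Lemma trmx_sqrtmx : (sqrtmx M)^T = sqrtmx M.
Proof. exact/symmetricmxP/sqrtmxP.1.1. Qed.

Lemma sqrtmx_unit : sqrtmx M \in unitmx.
Proof. by have := pdmx_unit; rewrite -{1}sqrtmxP.2 unitmx_mul andbb. Qed.

Definition whiten n (H : 'M[R]_(m, n)) : 'M[R]_(m, n) := invmx (sqrtmx M) *m H.

Lemma whiten_gram n (H : 'M[R]_(m, n)) :
  (whiten H)^T *m whiten H = H^T *m invmx M *m H.
Proof.
rewrite /whiten trmx_mul trmx_inv trmx_sqrtmx !mulmxA; congr (_ *m _).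
rewrite -!mulmxA; congr (_ *m _); apply: (can_inj (mulKmx pdmx_unit)).
rewrite mulmxV ?pdmx_unit // -{1}sqrtmxP.2 -!mulmxA mulKVmx ?sqrtmx_unit //.
by rewrite mulmxV ?sqrtmx_unit.
Qed.

Lemma trmx_whiten n (H : 'M[R]_(m, n)) :
  (whiten H)^T = H^T *m invmx M *m sqrtmx M.
Proof.
rewrite /whiten trmx_mul trmx_inv trmx_sqrtmx -mulmxA; congr (_ *m _).
apply: (can_inj (mulKmx pdmx_unit)); rewrite mulmxA mulmxV ?pdmx_unit // mul1mx.
by rewrite -{1}sqrtmxP.2 -mulmxA mulmxV ?sqrtmx_unit // mulmx1.
Qed.

Lemma mulmx_sqrt_whiten n k (K : 'M[R]_(k, m)) (H : 'M[R]_(m, n)) :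
  (K *m sqrtmx M) *m whiten H = K *m H.
Proof. by rewrite /whiten -mulmxA mulKVmx ?sqrtmx_unit. Qed.

End SqrtWhitening.

(** * Covariance intersection as the optimum for a fixed weight *)

Section Reduction.
Variables (R : realType) (n p1 p2 : nat).
Variables (H1 : 'M[R]_(p1, n)) (H2 : 'M[R]_(p2, n)) (d : fusion_input R p1 p2).

Local Notation S1 := (sqrtmx (Phat1 d)).
Local Notation S2 := (sqrtmx (Phat2 d)).
Local Notation Y1 := (whiten (Phat1 d) H1).
Local Notation Y2 := (whiten (Phat2 d) H2).
Let pd1 := Phat1_pd d.
Let pd2 := Phat2_pd d.

Lemma sdp_matrixE a (K1 : 'M[R]_(n, p1)) (K2 : 'M[R]_(n, p2)) (Q : 'M[R]_n) :
  sdp_matrix d a K1 K2 Q = arrow_mx a (K1 *m S1) (K2 *m S2) Q.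
Proof.
by rewrite /sdp_matrix /arrow_mx !trmx_mul (trmx_sqrtmx pd1) (trmx_sqrtmx pd2).
Qed.

Lemma ci_informationE a : ci_information H1 H2 d a = weighted_gram Y1 Y2 a.
Proof. by rewrite /weighted_gram (whiten_gram pd1) (whiten_gram pd2). Qed.

Lemma ci_covE a : ci_cov H1 H2 d a = weighted_cov Y1 Y2 a.
Proof. by rewrite /ci_cov ci_informationE. Qed.

Lemma ci_gain1_sqrt a :
  ci_gain1 H1 H2 d a *m S1 = a *: (ci_cov H1 H2 d a *m Y1^T).
Proof. by rewrite (trmx_whiten pd1) -scalemxAl !mulmxA. Qed.

Lemma ci_gain2_sqrt a :
  ci_gain2 H1 H2 d a *m S2 = (1 - a) *: (ci_cov H1 H2 d a *m Y2^T).
Proof. by rewrite (trmx_whiten pd2) -scalemxAl !mulmxA. Qed.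

(** For a fixed weight, the intersection covariance is the least feasible one, and
    it is reached by the intersection gains only. *)
Lemma sdp_feasible_bound a K1 K2 Q : (0 < p1)%N -> (0 < p2)%N ->
  sdp_feasible H1 H2 d a K1 K2 Q ->
  [/\ 0 <= a <= 1, ci_information H1 H2 d a \in unitmx,
      lemx (ci_cov H1 H2 d a) Q
    & Q = ci_cov H1 H2 d a ->
      K1 = ci_gain1 H1 H2 d a /\ K2 = ci_gain2 H1 H2 d a].
Proof.
move=> p1_gt0 p2_gt0 [_ psd unbiased]; rewrite sdp_matrixE in psd.
have wunbiased : (K1 *m S1) *m Y1 + (K2 *m S2) *m Y2 = 1%:M.
  by rewrite (mulmx_sqrt_whiten pd1) (mulmx_sqrt_whiten pd2).
split; first exact: arrow_mx_weight psd.
- by rewrite ci_informationE; exact: weighted_gram_unit wunbiased psd.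
- by rewrite ci_covE; exact: weighted_cov_le wunbiased psd.
rewrite ci_covE => /(optimal_gain_unique wunbiased psd)[].
rewrite -ci_covE -ci_gain1_sqrt -ci_gain2_sqrt => g1 g2.
by split; [move: g1 | move: g2]; apply/(can_inj (mulmxK _))/sqrtmx_unit.
Qed.

Lemma sdp_feasible_ci a : 0 <= a <= 1 ->
  ci_information H1 H2 d a \in unitmx ->
  sdp_feasible H1 H2 d a (ci_gain1 H1 H2 d a) (ci_gain2 H1 H2 d a)
    (ci_cov H1 H2 d a).
Proof.
rewrite ci_informationE => a01 unitW; split.
- by rewrite ci_covE; exact: psdmx_weighted_cov.
- rewrite sdp_matrixE ci_gain1_sqrt ci_gain2_sqrt ci_covE.
  exact: psdmx_arrow_optimal.
rewrite -(mulmx_sqrt_whiten pd1) -[X in _ + X](mulmx_sqrt_whiten pd2).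
by rewrite ci_gain1_sqrt ci_gain2_sqrt ci_covE; exact: optimal_gain_unbiased.
Qed.

(** With equal positive weights, the kernel of the information matrix is the common
    kernel of [H1] and [H2]. *)
Lemma ci_information_half_unit : \rank (col_mx H1 H2) = n ->
  ci_information H1 H2 d 2^-1 \in unitmx.
Proof.
move=> rankH; rewrite ci_informationE; apply: unitmx_inj_mul => x Wx.
have : (x^T *m weighted_gram Y1 Y2 2^-1 *m x) 0 0 = 0.
  by rewrite -mulmxA Wx mulmx0 mxE.
have -> : x^T *m weighted_gram Y1 Y2 2^-1 *m x =
  2^-1 *: ((Y1 *m x)^T *m (Y1 *m x) + (Y2 *m x)^T *m (Y2 *m x)).
  have half : 1 - 2^-1 = 2^-1 :> R by lra.
  rewrite /weighted_gram half -scalerDr -scalemxAr -scalemxAl.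
  by rewrite mulmxDr mulmxDl !trmx_mul !mulmxA.
rewrite mxE => /eqP; rewrite mulf_eq0 invr_eq0 pnatr_eq0 /= mxE.
rewrite paddr_eq0 ?mulmx_tr_self_ge0 // => /andP[/eqP /mulmx_tr_self_eq0 Y1x].
move=> /eqP /mulmx_tr_self_eq0 Y2x.
have Hx : col_mx H1 H2 *m x = 0.
  rewrite mul_col_mx -[H1 *m x](mulKVmx (sqrtmx_unit pd1)).
  rewrite -[H2 *m x](mulKVmx (sqrtmx_unit pd2)) ![invmx _ *m (_ *m _)]mulmxA.
  by rewrite Y1x Y2x !mulmx0 col_mx0.
have /row_fullP[B BH] : row_full (col_mx H1 H2) by rewrite /row_full rankH.
by rewrite -[x]mul1mx -BH -mulmxA Hx mulmx0.
Qed.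

End Reduction.

(** * Equivalence of the two problems *)

Theorem theorem29 (R : realType) (n p1 p2 : nat)
    (n_gt0 : (0 < n)%N) (p1_gt0 : (0 < p1)%N) (p2_gt0 : (0 < p2)%N)
    (p1_le_n : (p1 <= n)%N) (p2_le_n : (p2 <= n)%N)
    (H1 : 'M[R]_(p1, n)) (H2 : 'M[R]_(p2, n))
    (J : 'M[R]_n -> R)
    (J_isotone : strictly_isotone J)
    (A1 : rank_assumption H1 H2)
    (alpha : fusion_input R p1 p2 -> R)
    (K1 : fusion_input R p1 p2 -> 'M[R]_(n, p1))
    (K2 : fusion_input R p1 p2 -> 'M[R]_(n, p2))
    (P : fusion_input R p1 p2 -> 'M[R]_n)
    (P_psd : forall d : fusion_input R p1 p2, psdmx (P d)) :
  sdp_solution H1 H2 J alpha K1 K2 P <->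
  (ci_solution H1 H2 J alpha /\
   forall d : fusion_input R p1 p2,
     [/\ K1 d = ci_gain1 H1 H2 d (alpha d),
         K2 d = ci_gain2 H1 H2 d (alpha d)
       & P d = ci_cov H1 H2 d (alpha d)]).
Proof.
have [_ _ rankH] := A1.
have ci_costE d a : ci_information H1 H2 d a \in unitmx ->
    ci_cost H1 H2 J d a = (J (ci_cov H1 H2 d a))%:E.
  by rewrite /ci_cost /extended_inverse => ->.
split=> [sdp|[[alpha01 ci_opt] ci_form] d].
  have ci_form d : [/\ K1 d = ci_gain1 H1 H2 d (alpha d),
      K2 d = ci_gain2 H1 H2 d (alpha d) & P d = ci_cov H1 H2 d (alpha d)].
    have [feas opt] := sdp d.
    have [a01 unitW cov_le gains] := sdp_feasible_bound p1_gt0 p2_gt0 feas.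
    have feas_ci := sdp_feasible_ci a01 unitW.
    (* By strictness, a covariance other than the least one would cost more. *)
    suff PE : P d = ci_cov H1 H2 d (alpha d) by have [] := gains PE.
    apply/eqP; apply: contraT => P_neq.
    have [[symC _] _ _] := feas_ci; have [symP _] := P_psd d.
    have := (J_isotone _ _ symC symP).2 cov_le; rewrite eq_sym => /(_ P_neq).
    by rewrite ltNge (opt _ _ _ _ feas_ci).
  split=> //; split=> [d|d beta beta01].
    by have [feas _] := sdp d; have [] := sdp_feasible_bound p1_gt0 p2_gt0 feas.
  have [feas opt] := sdp d.
  have [_ unitW _ _] := sdp_feasible_bound p1_gt0 p2_gt0 feas.
  rewrite ci_costE //.
  have [unitB|] := boolP (ci_information H1 H2 d (beta d) \in unitmx).
    have [_ _ <-] := ci_form d; rewrite ci_costE // lee_fin.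
    exact: opt (sdp_feasible_ci (beta01 d) unitB).
  by rewrite /ci_cost /extended_inverse => /negbTE ->; rewrite leey.
(* Otherwise the cost would be infinite, while the constant weight 1/2 has
   finite cost. *)
have unitW : ci_information H1 H2 d (alpha d) \in unitmx.
  apply: contraT => singular.
  have half01 : unit_valued (fun _ : fusion_input R p1 p2 => 2^-1 : R).
    by move=> _; apply/andP; split; lra.
  have := ci_opt d _ half01.
  rewrite (ci_costE d 2^-1) ?ci_information_half_unit //.
  by rewrite /ci_cost /extended_inverse (negbTE singular) /= leye_eq.
have feas_ci := sdp_feasible_ci (alpha01 d) unitW.
have [-> -> ->] := ci_form d; split=> // a L1 L2 Q feas.
have [a01 unitA cov_le _] := sdp_feasible_bound p1_gt0 p2_gt0 feas.
have [[symA _] _ _] := sdp_feasible_ci a01 unitA; have [[symQ _] _ _] := feas.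
apply: le_trans ((J_isotone _ _ symA symQ).1 cov_le).
by have := ci_opt d (fun=> a) (fun=> a01); rewrite !ci_costE // lee_fin.
Qed.
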